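(* Let $\sigma : X^* \to M$ be a monoid choice of generators for a monoid $M$ and suppose $w \in L_\sigma(M)$. Then $w$ labels a loop (a path from a vertex to itself) at every vertex of the loop automaton of $M$ with respect to $\sigma$. Correspondingly, if $\sigma : X^+ \to S$ is a semigroup choice of generators for a semigroup $S$ and $w \in L_\sigma(S)$, then $w$ labels a loop at every vertex of the loop automaton of $S$ with respect to $\sigma$.
   Context: Maps are written on the right. $X^*$, $X^+$: free monoid and free semigroup on $X$. Let $\overline{X} = \{\overline{x} : x \in X\}$ be new symbols, $\hat{X} = X \cup \overline{X}$. For a monoid $M$ and surjective monoid morphism $\sigma : X^* \to M$, the loop automaton has vertex set $M$, for each $a \in M$, $x \in X$ an edge $a \to a(x\sigma)$ labelled $x$ and an edge $a(x\sigma) \to a$ labelled $\overline{x}$; the loop problem $L_\sigma(M)$ is the set of labels of paths from the identity to the identity. For a semigroup $S$ and surjective morphism $\sigma : X^+ \to S$, the loop automaton and loop problem of $S$ are those of $S^1$ ($S$ with a new identity adjoined, even if one exists) with respect to the unique extension $\sigma^1 : X^* \to S^1$. *)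

(* Defs.v *)
(* Stdlib / plain Rocq world: abstract monoids and semigroups given by explicit
   operations and axioms, words as lists. Maps are written on the right:
   a(x sigma) is  mul a (sigma [x]). *)
From Stdlib Require Import List.
Import ListNotations.
Set Implicit Arguments.

Definition is_monoid (M : Type) (mul : M -> M -> M) (one : M) : Prop :=
  (forall a b c, mul a (mul b c) = mul (mul a b) c) /\
  (forall a, mul one a = a) /\ (forall a, mul a one = a).

Definition is_semigroup (S : Type) (mul : S -> S -> S) : Prop :=
  forall a b c, mul a (mul b c) = mul (mul a b) c.

(* Letters of hat X = X u bar X:  Pos x is x,  Bar x is bar x. *)
Inductive hat (X : Type) : Type := Pos (x : X) | Bar (x : X).
Arguments Pos {X} x.
Arguments Bar {X} x.

Definition monoid_choice_of_generators (X M : Type) (mul : M -> M -> M) (one : M)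
    (sigma : list X -> M) : Prop :=
  sigma [] = one /\
  (forall u v, sigma (u ++ v) = mul (sigma u) (sigma v)) /\
  (forall m, exists w, sigma w = m).

(* sigma : X^+ -> S is a surjective semigroup morphism; X^+ = nonempty lists,
   the value of sigma on the empty list is irrelevant (never used). *)
Definition semigroup_choice_of_generators (X S : Type) (mul : S -> S -> S)
    (sigma : list X -> S) : Prop :=
  (forall u v, u <> [] -> v <> [] -> sigma (u ++ v) = mul (sigma u) (sigma v)) /\
  (forall s, exists w, w <> [] /\ sigma w = s).

Definition loop_edge (X M : Type) (mul : M -> M -> M) (sigma : list X -> M)
    (a : M) (l : hat X) (b : M) : Prop :=
  match l with
  | Pos x => b = mul a (sigma [x])
  | Bar x => a = mul b (sigma [x])
  end.

Fixpoint loop_path (X M : Type) (mul : M -> M -> M) (sigma : list X -> M)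
    (a : M) (w : list (hat X)) (b : M) : Prop :=
  match w with
  | [] => a = b
  | l :: w' => exists c, loop_edge mul sigma a l c /\ loop_path mul sigma c w' b
  end.

Definition loop_problem (X M : Type) (mul : M -> M -> M) (one : M)
    (sigma : list X -> M) (w : list (hat X)) : Prop :=
  loop_path mul sigma one w one.

(* S^1: S with a new identity adjoined (None is the new identity). *)
Definition adjoin_one_mul (S : Type) (mul : S -> S -> S)
    (a b : option S) : option S :=
  match a, b with
  | None, _ => b
  | _, None => a
  | Some x, Some y => Some (mul x y)
  end.

Definition sigma_one (X S : Type) (sigma : list X -> S) (w : list X) : option S :=
  match w with
  | [] => None
  | _ => Some (sigma w)
  end.

Definition sg_loop_path (X S : Type) (mul : S -> S -> S) (sigma : list X -> S)
    (a : option S) (w : list (hat X)) (b : option S) : Prop :=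
  loop_path (adjoin_one_mul mul) (sigma_one sigma) a w b.

Definition sg_loop_problem (X S : Type) (mul : S -> S -> S) (sigma : list X -> S)
    (w : list (hat X)) : Prop :=
  loop_problem (adjoin_one_mul mul) None (sigma_one sigma) w.

(* Main.v *)
(* Left multiplication by a vertex a maps every edge c --l--> d of the loop
   automaton to an edge a c --l--> a d, by associativity alone. Translating a
   loop at the identity therefore gives a loop at a 1 = a. The semigroup case is
   the monoid case for S^1, whose multiplication is again associative. *)
Require Import Defs.
From Stdlib Require Import List.

Set Implicit Arguments.

Section LeftTranslation.

Variables (X M : Type) (mul : M -> M -> M) (sigma : list X -> M).
Hypothesis mulA : forall a b c, mul a (mul b c) = mul (mul a b) c.

Lemma loop_edge_mull (a c d : M) (l : hat X) :
  loop_edge mul sigma c l d -> loop_edge mul sigma (mul a c) l (mul a d).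
Proof.
  destruct l as [x|x]; simpl; intros ->; apply mulA.
Qed.

Lemma loop_path_mull (a : M) (w : list (hat X)) :
  forall c d, loop_path mul sigma c w d ->
  loop_path mul sigma (mul a c) w (mul a d).
Proof.
  induction w as [|l w IHw]; simpl; intros c d.
  - intros ->; reflexivity.
  - intros [e [Hedge Hpath]].
    exists (mul a e); split.
    + apply loop_edge_mull; exact Hedge.
    + apply IHw; exact Hpath.
Qed.

Lemma loop_problem_loop_path (one : M) (w : list (hat X)) :
  (forall a, mul a one = a) ->
  loop_problem mul one sigma w -> forall a, loop_path mul sigma a w a.
Proof.
  intros mulr1 Hloop a.
  rewrite <- (mulr1 a).
  apply loop_path_mull; exact Hloop.
Qed.

End LeftTranslation.

Lemma adjoin_one_mulA (S : Type) (mul : S -> S -> S) :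
  is_semigroup mul ->
  forall a b c : option S,
    adjoin_one_mul mul a (adjoin_one_mul mul b c)
    = adjoin_one_mul mul (adjoin_one_mul mul a b) c.
Proof.
  intros mulA [x|] [y|] [z|]; simpl; try reflexivity.
  rewrite mulA; reflexivity.
Qed.

Lemma adjoin_one_mulr1 (S : Type) (mul : S -> S -> S) (a : option S) :
  adjoin_one_mul mul a None = a.
Proof.
  destruct a; reflexivity.
Qed.

Theorem lemma4p4 :
  (forall (X M : Type) (mul : M -> M -> M) (one : M) (sigma : list X -> M)
     (w : list (hat X)),
     is_monoid mul one ->
     monoid_choice_of_generators mul one sigma ->
     loop_problem mul one sigma w ->
     forall a : M, loop_path mul sigma a w a)
  /\
  (forall (X S : Type) (mul : S -> S -> S) (sigma : list X -> S)
     (w : list (hat X)),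
     is_semigroup mul ->
     semigroup_choice_of_generators mul sigma ->
     sg_loop_problem mul sigma w ->
     forall a : option S, sg_loop_path mul sigma a w a).
Proof.
  split.
  - intros X M mul one sigma w [mulA [_ mulr1]] _.
    exact (loop_problem_loop_path mul sigma mulA one w mulr1).
  - intros X S mul sigma w Hsemigroup _.
    exact (loop_problem_loop_path _ (sigma_one sigma) (adjoin_one_mulA Hsemigroup)
             None w (adjoin_one_mulr1 mul)).
Qed.
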